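(* Let $\Lambda$ be a finite $k$-graph without sinks or sources such that the subgraphs $\{\Lambda_C:C\in\mathcal{C}\}$ are all coordinatewise irreducible. Suppose that $D\in\mathcal{C}$ is hereditary and satisfies $C\Lambda^{\mathbb{N}e_i}D\ne\emptyset$ for all $C\in\mathcal{C}$ and $1\le i\le k$. If there exists $j\in\{1,\dots,k\}$ such that $\rho(A_{C,j})<\rho(A_{D,j})$ for all $C\in\mathcal{C}\setminus\{D\}$, then $$\rho(A_{C,i})<\rho(A_{D,i})\quad\text{for all }C\in\mathcal{C}\setminus\{D\}\text{ and }1\le i\le k.$$
   Context: $\mathbb{N}=\{0,1,2,\dots\}$. A $k$-graph is a countable category $\Lambda$ with a functor $d:\Lambda\to\mathbb{N}^k$ such that whenever $d(\lambda)=m+n$ there are unique $\mu,\nu\in\Lambda$ with $d(\mu)=m$, $d(\nu)=n$, $\lambda=\mu\nu$. $\Lambda^n:=d^{-1}(n)$; $\Lambda^0$ (the vertices) is identified with the objects. The maps $s,r:\Lambda\to\Lambda^0$ are domain and codomain. For $V\subset\Lambda^0$, $E\subset\Lambda$: $VE=\{\lambda\in E:r(\lambda)\in V\}$, $EV=\{\lambda\in E:s(\lambda)\in V\}$, $vE=\{v\}E$, $Ev=E\{v\}$. $e_1,\dots,e_k$ are the generators of $\mathbb{N}^k$, and $\Lambda^{\mathbb{N}e_i}=\bigcup_{n\in\mathbb{N}}\Lambda^{ne_i}$. $\Lambda$ is finite if every $\Lambda^n$ is finite; it has no sources (sinks) if $v\Lambda^n\ne\emptyset$ ($\Lambda^nv\neq\emptyset$)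 for all $v\in\Lambda^0$, $n\in\mathbb{N}^k$. The vertex matrix $A_i$ is the $\Lambda^0\times\Lambda^0$ matrix $A_i(v,w)=|v\Lambda^{e_i}w|$; for $C\subset\Lambda^0$, $A_{C,i}$ is its $C\times C$ block; $\rho$ is the spectral radius. A square matrix $A$ is irreducible if for all $i,j$ there is $m\in\mathbb{N}$ with $A^m(i,j)\ne0$. Strongly connected components are the classes of the relation $v\sim w\iff v\Lambda w\neq\emptyset$ and $w\Lambda v\ne\emptyset$; a class $\{v\}$ with $v\Lambda v=\{v\}$ is trivial; $\mathcal{C}$ is the set of nontrivial strongly connected components. For $C\in\mathcal{C}$, $\Lambda_C:=C\Lambda C$ is a $k$-graph; it is coordinatewise irreducible if all $A_{C,i}$ ($1\le i\le k$) are irreducible. A set $H\subset\Lambda^0$ is hereditary if $v\in H$ and $v\Lambda w\ne\emptyset$ imply $w\in H$. *)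

(* Defs.v *)
From HB Require Import structures.
From mathcomp Require Import all_boot all_order all_algebra.
From mathcomp Require Import finmap.
From mathcomp Require Import boolp classical_sets functions cardinality reals.
From mathcomp Require Import complex.

Set Implicit Arguments.
Unset Strict Implicit.
Unset Printing Implicit Defensive.

Import Order.TTheory GRing.Theory Num.Theory.
Local Open Scope classical_set_scope.
Local Open Scope ring_scope.

(* A k-graph, as a category with a set of objects and a set of morphisms.
   [compose m n] is the composite of [n] followed by [m]; it is a total function
   whose value is only constrained when [src m = rng n]. By [factorization] the
   morphisms of degree 0 are exactly the identities, so that Lambda^0 is
   identified with [vert] through [idm]. *)
Record kgraph (k : nat) := KGraph {
  vert : countType;
  mor :> countType;
  src : mor -> vert;
  rng : mor -> vert;
  idm : vert -> mor;
  compose : mor -> mor -> mor;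
  deg : mor -> 'rV[nat]_k;
  src_idm : forall v, src (idm v) = v;
  rng_idm : forall v, rng (idm v) = v;
  src_comp : forall m n, src m = rng n -> src (compose m n) = src n;
  rng_comp : forall m n, src m = rng n -> rng (compose m n) = rng m;
  comp_idl : forall m, compose (idm (rng m)) m = m;
  comp_idr : forall m, compose m (idm (src m)) = m;
  compA : forall l m n, src l = rng m -> src m = rng n ->
    compose l (compose m n) = compose (compose l m) n;
  deg_idm : forall v, deg (idm v) = 0;
  deg_comp : forall m n, src m = rng n -> deg (compose m n) = deg m + deg n;
  factorization : forall l (m n : 'rV[nat]_k), deg l = m + n ->
    exists! p : mor * mor,
      [/\ src p.1 = rng p.2, deg p.1 = m, deg p.2 = n & l = compose p.1 p.2]
}.

Section KGraphTheory.
Variables (k : nat) (L : kgraph k).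
Implicit Types (V W C H : set (vert L)) (E : set L) (v w : vert L).

Definition degset (n : 'rV[nat]_k) : set L := [set l | deg l = n].

(* V E W in the usual notation: the morphisms of E from W to V *)
Definition paths V E W : set L :=
  [set l | [/\ E l, V (rng l) & W (src l)]].

Definition unitdeg (i : 'I_k) : 'rV[nat]_k := delta_mx 0 i.

Definition degray (i : 'I_k) : set L :=
  \bigcup_(n : nat) degset (unitdeg i *+ n).

Definition finite_kgraph : Prop := forall n, finite_set (degset n).

Definition no_sources : Prop :=
  forall v n, paths [set v] (degset n) setT !=set0.

Definition no_sinks : Prop :=
  forall v n, paths setT (degset n) [set v] !=set0.

Definition reaches v w : Prop := paths [set v] setT [set w] !=set0.

Definition trivial_class C : Prop :=
  exists v, C = [set v] /\ paths [set v] setT [set v] = [set idm v].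

Definition ncomponents : set (set (vert L)) :=
  [set C | (exists v, C = [set w | reaches v w /\ reaches w v])
           /\ ~ trivial_class C].

Definition hereditary H : Prop :=
  forall v w, H v -> reaches v w -> H w.

(* [fset_set A] is the finite set A, and fset0 by convention if A is infinite *)
Definition vertex_matrix (i : 'I_k) v w : nat :=
  #|` fset_set (paths [set v] (degset (unitdeg i)) [set w])|.

(* The rows and columns of A_{C,i} are indexed by an enumeration of C. *)
Definition block_matrix C (i : 'I_k) : 'M[nat]_#|{: fset_set C}| :=
  \matrix_(a, b) vertex_matrix i (val (enum_val a)) (val (enum_val b)).

End KGraphTheory.

Arguments ncomponents {k} L _.
Arguments degset {k} L n _.
Arguments degray {k} L i _.

Definition irreducible_mx (S : pzSemiRingType) n (A : 'M[S]_n) : Prop :=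
  forall i j, exists m : nat, (A ^+ m) i j != 0.

Definition coordinatewise_irreducible k (L : kgraph k) (C : set (vert L)) :=
  forall i, irreducible_mx (block_matrix C i).

Definition spectral_radius (R : realType) n (A : 'M[R[i]]_n) : R :=
  sup [set ComplexField.Normc.normc z | z in [set z | eigenvalue A z]].

Definition rho (R : realType) k (L : kgraph k) (C : set (vert L)) (i : 'I_k)
    : R :=
  spectral_radius (map_mx (fun n : nat => n%:R : R[i]) (block_matrix C i)).

(* Main.v *)
Require Import Defs.
From mathcomp Require Import all_boot all_order all_algebra.
From mathcomp Require Import finmap.
From mathcomp Require Import boolp classical_sets functions cardinality reals.
From mathcomp Require Import topology normedtype derive.
From mathcomp Require Import complex.

(* Let A_i be the vertex matrices of L and t := rho(A_{D,j}). By the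
   factorization property the A_i commute, and A_{D,i} is a diagonal block of
   A_i because D is hereditary. The Perron-Frobenius vector x > 0 of A_{D,j} is
   thus an eigenvector of every A_{D,i}, for the eigenvalue rho(A_{D,i}). Off D
   every diagonal block of A_j has spectral radius < t, so x extends uniquely
   to a vector z on all vertices with A_j z = t z, and z >= 0. As A_i z has the
   same property with rho(A_{D,i}) x in place of x, uniqueness gives
   A_i z = rho(A_{D,i}) z. On C this reads A_{C,i} z <= rho(A_{D,i}) z, strictly
   at a vertex where a path of degree in N e_i from C to D leaves C. Pairing
   with a positive left eigenvector of A_{C,i} gives
   rho(A_{C,i}) < rho(A_{D,i}). *)

Set Implicit Arguments.
Unset Strict Implicit.
Unset Printing Implicit Defensive.

Import Order.TTheory GRing.Theory Num.Theory.
Import numFieldNormedType.Exports.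
Local Open Scope classical_set_scope.
Local Open Scope ring_scope.

(** * Nonnegative matrices *)

Section Spectral.
Variables (R : realType) (n : nat).
Implicit Types (A : 'M[R]_n) (p : 'rV[R]_n) (t : R).

Definition spr A : R := spectral_radius (map_mx (real_complex R) A).

Lemma eigenvalue_trmx (F : fieldType) (B : 'M[F]_n) a :
  eigenvalue B^T a = eigenvalue B a.
Proof.
rewrite !eigenvalue_root_char /char_poly -det_tr; congr (root (\det _) a).
by apply/matrixP => i j; rewrite !mxE eq_sym.
Qed.

Lemma spr_trmx A : spr A^T = spr A.
Proof.
rewrite /spr /spectral_radius -map_trmx.
suff -> : eigenvalue (map_mx (real_complex R) A)^T =
  eigenvalue (map_mx (real_complex R) A) by [].
by apply/funext => z; rewrite eigenvalue_trmx.
Qed.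

(** [p] serves as a weight: if A v = z v, then |z| |v| <= A |v| entrywise, and pairing with [p]
    gives |z| (p |v|) <= t (p |v|) with p |v| > 0. The index [i0] rules out the empty matrix. *)
Lemma spr_eigen_row A p t (i0 : 'I_n) : (forall i j, 0 <= A i j) ->
  (forall i, 0 < p 0 i) -> p *m A = t *: p -> spr A = t.
Proof.
move=> A0 p0 pA.
have t0 : 0 <= t.
  rewrite -(pmulr_lge0 t (p0 i0)).
  have -> : t * p 0 i0 = (p *m A) 0 i0 by rewrite pA !mxE.
  by rewrite mxE sumr_ge0// => j _; rewrite mulr_ge0// ltW.
pose E := [set ComplexField.Normc.normc z |
  z in [set z | eigenvalue (map_mx (real_complex R) A) z]].
have Et : E t.
  exists (t%:C)%C; last by rewrite /= expr0n /= addr0 sqrtr_sqr ger0_norm.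
  apply/eigenvalueP; exists (map_mx (real_complex R) p).
    by rewrite -map_mxM pA map_mxZ.
  apply/eqP => /rowP /(_ i0); rewrite !mxE => /complexI p00.
  by have := p0 i0; rewrite p00 ltxx.
have ubE : ubound E t.
  (* [eigenvalueP] speaks of row vectors; the transpose makes [v] a right eigenvector of [A], to be
     paired with the left eigenvector [p]. *)
  move=> _ [z /= zA <-]; move: zA; rewrite -eigenvalue_trmx.
  move=> /eigenvalueP[v vA v0].
  suff : `|z| <= (t%:C)%C by rewrite lecR.
  have S0 : 0 < \sum_a (p 0 a)%:C%C * `|v 0 a|.
    have /rV0Pn[a va] := v0.
    rewrite (bigD1 a)//= ltr_pwDl//.
      by rewrite mulr_gt0 ?normr_gt0// ltcR.
    by rewrite sumr_ge0// => b _; rewrite mulr_ge0// lecR ltW.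
  rewrite -(ler_pM2r S0) !mulr_sumr.
  apply: (@le_trans _ _
    (\sum_a (p 0 a)%:C%C * (\sum_b (A a b)%:C%C * `|v 0 b|))).
    apply: ler_sum => a _; rewrite mulrCA ler_wpM2l ?lecR ?(ltW (p0 a))//.
    rewrite -normrM.
    have -> : z * v 0 a = (v *m (map_mx (real_complex R) A)^T) 0 a.
      by rewrite vA mxE.
    rewrite mxE; apply: le_trans (ler_norm_sum _ _ _) _; apply: ler_sum => b _.
    by rewrite normrM !mxE mulrC ger0_norm ?lecR.
  under eq_bigr do rewrite mulr_sumr.
  rewrite exchange_big /= ler_sum// => b _.
  under eq_bigr do rewrite mulrA -rmorphM/=.
  rewrite -mulr_suml -rmorph_sum/= mulrA -rmorphM/=.
  suff -> : \sum_i p 0 i * A i b = t * p 0 b by rewrite !rmorphM.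
  by have /rowP/(_ b) := pA; rewrite !mxE.
apply/le_anti/andP; split; first by apply: ge_sup => //; exists t.
by apply: ub_le_sup => //; exists t.
Qed.

Lemma spr_eigen_col A (x : 'cV[R]_n) t (i0 : 'I_n) :
  (forall i j, 0 <= A i j) -> (forall i, 0 < x i 0) -> A *m x = t *: x ->
  spr A = t.
Proof.
move=> A0 x0 Ax; rewrite -spr_trmx; apply: (@spr_eigen_row _ x^T) => //.
- by move=> i j; rewrite mxE.
- by move=> i; rewrite mxE.
- by rewrite -trmx_mul Ax linearZ.
Qed.

End Spectral.

(** * Perron-Frobenius theorem for irreducible matrices *)

Section PerronFrobenius.
Variables (R : realType) (n : nat).
Implicit Types (A B : 'M[R]_n) (p x : 'rV[R]_n) (t : R).

Lemma expmx_ge0 A k : (forall i j, 0 <= A i j) -> forall i j, 0 <= (A ^+ k) i j.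
Proof.
move=> A0; elim: k => [|k IH] i j; first by rewrite expr0 mxE ler0n.
by rewrite exprS -mulmxE mxE sumr_ge0// => l _; rewrite mulr_ge0.
Qed.

(** [B] is the sum of the powers of [A] up to the largest exponent needed to witness irreducibility,
    hence a polynomial in [A]. *)
Lemma irreducible_positive_commutant A : (forall i j, 0 <= A i j) ->
  irreducible_mx A ->
  exists B, (forall i j, 0 < B i j) /\ A *m B = B *m A.
Proof.
move=> A0 /(_ _ _)/cid irr.
pose m i j := sval (irr i j).
have mP i j : (A ^+ m i j) i j != 0 by exact: svalP (irr i j).
pose N := \max_i \max_j m i j.
exists (\sum_(k < N.+1) A ^+ k); split.
  move=> i j; have mN : (m i j < N.+1)%N.
    by rewrite ltnS /N (leq_trans (leq_bigmax j))//
      (leq_bigmax (F := fun i => \max_j m i j)).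
  rewrite summxE (bigD1 (Ordinal mN))//= ltr_pwDl//.
    by rewrite lt0r mP expmx_ge0.
  by rewrite sumr_ge0// => k _; exact: expmx_ge0.
rewrite mulmx_sumr mulmx_suml; apply: eq_bigr => k _.
by rewrite !mulmxE -exprS -exprSr.
Qed.

Lemma mulmx_pos_row x B : (forall i j, 0 < B i j) ->
  (forall i, 0 <= x 0 i) -> x != 0 -> forall j, 0 < (x *m B) 0 j.
Proof.
move=> B0 x0 /rV0Pn[a xa] j; rewrite mxE (bigD1 a)//= ltr_pwDl//.
  by rewrite mulr_gt0// lt0r xa x0.
by rewrite sumr_ge0// => b _; rewrite mulr_ge0// ltW.
Qed.

(* The pairs (x, t) with x in the simplex, t >= 0 and t x <= x A form a compact
   set, on which t attains its maximum. *)
Lemma max_subeigen A (i0 : 'I_n) : (forall i j, 0 <= A i j) ->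
  let sub x t := forall i, t * x 0 i <= (x *m A) 0 i in
  let nng x := (forall i, 0 <= x 0 i) /\ x != 0 in
  exists x t, [/\ nng x, sub x t &
    forall y s, nng y -> sub y s -> s <= t].
Proof.
move=> A0 sub nng.
(* Summing t x <= x A over the coordinates of a point of the simplex gives t <= [M], so confining t
   to [0, M] loses no pair with t >= 0. *)
pose M := \sum_i \sum_j A i j.
pose cube := [set x : 'rV[R]_n | forall i, `[0, 1]%classic (x 0 i)].
pose K : set ('rV[R]_n * R) := (cube `*` `[0, M]) `&`
  ([set z : 'rV[R]_n * R | \sum_i z.1 0 i = 1] `&`
   \bigcap_(i in [set: 'I_n]) [set z : 'rV[R]_n * R |
     z.2 * z.1 0 i - (z.1 *m A) 0 i <= 0]).
have cK : compact K.
  apply: compact_closedI.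
    apply: compact_setX; last exact: segment_compact.
    by apply: (@rV_compact R n (fun=> [set` `[0, 1]%R])) => i;
      exact: segment_compact.
  have c1 i : continuous (fun z : 'rV[R]_n * R => z.1 0 i).
    move=> z; apply: (@continuous_comp _ _ _ fst (fun x : 'rV[R]_n => x 0 i)).
      exact: cvg_fst.
    exact: coord_continuous.
  have csum (F : 'I_n -> 'rV[R]_n * R -> R) :
      (forall i, continuous (F i)) -> continuous (fun z => \sum_i F i z).
    by move=> cF; apply: continuous_big => //; exact: add_continuous.
  apply: closedI.
    apply: (@closed_comp _ _ (fun z : 'rV[R]_n * R => \sum_i z.1 0 i) [set 1]).
      by move=> z _; exact: csum.
    exact: closed_eq.
  apply: closed_bigI => i _.
  apply: (@closed_comp _ _ (fun z : 'rV[R]_n * R =>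
    z.2 * z.1 0 i - (z.1 *m A) 0 i) [set x | x <= 0]); last exact: closed_le.
  move=> z _; apply: cvgB.
    by apply: cvgM; [exact: cvg_snd|exact: c1].
  under eq_fun do rewrite mxE.
  rewrite mxE; apply: (csum (fun j z => z.1 0 j * A j i)) => j y.
  by apply: cvgM; [exact: c1|exact: cvg_cst].
have K1 z : K z -> nng z.1.
  move=> [[/= z01 _] [/= z1 _]]; split=> [i|].
    by have := z01 i; rewrite /= in_itv/= => /andP[].
  apply/eqP => z0; move/eqP: z1; rewrite big1 ?(eq_sym 0) ?oner_eq0//.
  by move=> i _; rewrite z0 mxE.
have K2 y s : nng y -> sub y s -> 0 <= s -> K ((\sum_i y 0 i)^-1 *: y, s).
  move=> [y0 ynz] sy s0; set S := \sum_i y 0 i.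
  have S0 : 0 < S.
    have /rV0Pn[a ya] := ynz; rewrite /S (bigD1 a)//= ltr_pwDl//.
      by rewrite lt0r ya y0.
    by rewrite sumr_ge0.
  set w := S^-1 *: y.
  have w0 i : 0 <= w 0 i by rewrite mxE mulr_ge0// invr_ge0 ltW.
  have w1 : \sum_i w 0 i = 1.
    under eq_bigr do rewrite mxE; by rewrite -mulr_sumr mulVf ?gt_eqF.
  have w1i i : w 0 i <= 1 by rewrite -w1 (bigD1 i)//= lerDl sumr_ge0.
  have sw i : s * w 0 i <= (w *m A) 0 i.
    by rewrite -scalemxAl !mxE mulrCA ler_pM2l ?invr_gt0// (le_trans (sy i))// mxE.
  split; first split => /=.
  - by move=> i; rewrite /= in_itv/= w0 w1i.
  - rewrite in_itv/= s0/= -[s]mulr1 -w1 mulr_sumr.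
    apply: (@le_trans _ _ (\sum_i (w *m A) 0 i)); first exact: ler_sum.
    under eq_bigr do rewrite mxE.
    rewrite exchange_big/= ler_sum// => i _; rewrite ler_sum// => j _.
    by rewrite ler_piMl.
  split => //= i _ /=; by rewrite subr_le0.
have nng1 : nng (const_mx 1).
  split=> [i|]; first by rewrite mxE.
  by apply/rV0Pn; exists i0; rewrite mxE oner_eq0.
have K0 : K !=set0.
  exists ((\sum_i (const_mx 1 : 'rV[R]_n) 0 i)^-1 *: const_mx 1, 0).
  apply: K2 => // i; rewrite mul0r mxE sumr_ge0// => j _.
  by rewrite mulr_ge0// mxE.
have sndc : {within K, continuous (@snd 'rV[R]_n R)}.
  by apply: continuous_subspaceT => z; exact: cvg_snd.
have [[x t] /set_mem Kxt xtmax] := compact_EVT_max K0 cK sndc.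
exists x, t; split; first exact: (K1 _ Kxt).
  by move=> i; case: Kxt => _ [_ /(_ i I)]/=; rewrite subr_le0.
(* A negative [s] does not come from [K], but is below [t] since [t] lies in [0, M]. *)
move=> y s ny sy; have [s0|s0] := leP 0 s.
  by have /mem_set/xtmax := K2 _ _ ny sy s0.
rewrite (le_trans (ltW s0))//; case: Kxt => [[_ /=]].
by rewrite in_itv/= => /andP[].
Qed.

(* If x A <> t x for the maximal pair (x, t) of [max_subeigen] and B > 0
   commutes with A, then (x B) A > t (x B) entrywise, against the maximality of t. *)
Lemma perron_frobenius_row A (i0 : 'I_n) : (forall i j, 0 <= A i j) ->
  irreducible_mx A ->
  exists p, (forall i, 0 < p 0 i) /\ p *m A = spr A *: p.
Proof.
move=> A0 irr; have [x [t [[x0 xn0] sx tmax]]] := max_subeigen i0 A0.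
have [B [B0 AB]] := irreducible_positive_commutant A0 irr.
have p0 := mulmx_pos_row B0 x0 xn0.
suff xA : x *m A = t *: x.
  have pA : (x *m B) *m A = t *: (x *m B).
    by rewrite -mulmxA -AB mulmxA xA scalemxAl.
  by exists (x *m B); split; rewrite // (spr_eigen_row i0 A0 p0 pA).
apply/eqP; rewrite -subr_eq0; apply/negPn/negP => dn0.
have d0 i : 0 <= (x *m A - t *: x) 0 i.
  by have := sx i; rewrite !mxE subr_ge0.
have dB := mulmx_pos_row B0 d0 dn0.
set p := x *m B in p0.
have dBE i : t * p 0 i < (p *m A) 0 i.
  have := dB i; rewrite mulmxBl -mulmxA AB mulmxA -scalemxAl.
  by rewrite !mxE subr_gt0.
(* Collatz-Wielandt quotients: their minimum is admissible for [p], so at most [t] by maximality,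
   whereas [dBE] makes every quotient exceed [t]. *)
pose f i := (p *m A) 0 i / p 0 i.
pose a := [arg min_(i < i0) f i]%O.
have fa i : f a <= f i by rewrite /a; case: arg_minP => // b _; apply.
suff : f a <= t by rewrite ler_pdivrMr// leNgt dBE.
apply: (tmax p) => [|i]; last by rewrite -ler_pdivlMr//; exact: fa.
split=> [i|]; first exact: ltW.
by apply/rV0Pn; exists i0; rewrite gt_eqF.
Qed.

End PerronFrobenius.

(** * Subinvariant vectors, maximum principle, simplicity of the Perron eigenvalue *)

Section NonnegativeMatrices.
Variables (R : realType) (n : nat).
Implicit Types (A : 'M[R]_n) (x y u : 'cV[R]_n) (t : R).

Lemma irreducible_trmx A : irreducible_mx A -> irreducible_mx A^T.
Proof.
move=> irr i j; have [m Am] := irr j i; exists m.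
suff -> : A^T ^+ m = (A ^+ m)^T by rewrite mxE.
elim: m {Am} => [|m IH]; first by rewrite !expr0 trmx1.
by rewrite exprS exprSr IH -!mulmxE trmx_mul.
Qed.

Lemma perron_frobenius_col A (i0 : 'I_n) : (forall i j, 0 <= A i j) ->
  irreducible_mx A ->
  exists x, (forall i, 0 < x i 0) /\ A *m x = spr A *: x.
Proof.
move=> A0 irr.
have AT0 i j : 0 <= A^T i j by rewrite mxE.
have [p [p0 pA]] := perron_frobenius_row i0 AT0 (irreducible_trmx irr).
exists p^T; split => [i|]; first by rewrite mxE.
by have := congr1 trmx pA; rewrite trmx_mul trmxK linearZ/= spr_trmx.
Qed.

(** A positive left eigenvector [p] turns the entrywise inequalities, strict at [a], into spr(A) (p
    x) < t (p x); this excludes p x = 0 and allows division. *)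
Lemma spr_lt_subinvariant A x t (a : 'I_n) : (forall i j, 0 <= A i j) ->
  irreducible_mx A -> (forall i, 0 <= x i 0) ->
  (forall i, (A *m x) i 0 <= t * x i 0) -> (A *m x) a 0 < t * x a 0 ->
  spr A < t.
Proof.
move=> A0 irr x0 Ax Axa.
have [p [p0 pA]] := perron_frobenius_row a A0 irr.
have px0 : 0 <= (p *m x) 0 0.
  by rewrite mxE sumr_ge0// => i _; rewrite mulr_ge0// ltW.
have : spr A * (p *m x) 0 0 < t * (p *m x) 0 0.
  have -> : spr A * (p *m x) 0 0 = (p *m (A *m x)) 0 0.
    by rewrite mulmxA pA -scalemxAl [RHS]mxE.
  rewrite [X in X < _]mxE [X in _ < _ * X]mxE mulr_sumr.
  rewrite (bigD1 a)//= [ltRHS](bigD1 a)//= ltr_leD//.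
    by rewrite mulrCA ltr_pM2l.
  by apply: ler_sum => i _; rewrite mulrCA ler_wpM2l// ltW.
move: px0; rewrite le_eqVlt => /predU1P[<-|px0]; first by rewrite !mulr0 ltxx.
by rewrite ltr_pM2r.
Qed.

(* At an index where [y / u] attains its minimum [c < 0], the vector
   [y - c u >= 0] vanishes, while [t (y - c u) > A (y - c u) >= 0]. *)
Lemma maximum_principle A u t y : (forall i j, 0 <= A i j) ->
  (forall i, 0 < u i 0) -> (forall i, (A *m u) i 0 < t * u i 0) ->
  (forall i, (A *m y) i 0 <= t * y i 0) -> forall i, 0 <= y i 0.
Proof.
move=> A0 u0 Au Ay i.
pose f i := y i 0 / u i 0.
pose a := [arg min_(b < i) f b]%O.
have fa b : f a <= f b by rewrite /a; case: arg_minP => // c _; apply.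
rewrite leNgt; apply/negP => yi0.
have c0 : f a < 0.
  by rewrite (le_lt_trans (fa i))// /f pmulr_llt0// invr_gt0.
pose w := y - f a *: u.
have w0 b : 0 <= w b 0.
  by rewrite !mxE subr_ge0 -ler_pdivlMr//; exact: fa.
have wa : w a 0 = 0 by rewrite !mxE /f divfK ?subrr ?gt_eqF.
have Aw0 : 0 <= (A *m w) a 0 by rewrite mxE sumr_ge0// => b _; rewrite mulr_ge0.
have : (A *m w) a 0 < t * w a 0.
  rewrite /w mulmxBr -scalemxAr; move: (Au a) (Ay a).
  set Aua := (A *m u) a 0 => h1 h2.
  have -> : (A *m y - f a *: (A *m u)) a 0 = (A *m y) a 0 - f a * Aua.
    by rewrite mxE [X in _ + X]mxE [X in _ - X]mxE.
  have -> : t * (y - f a *: u) a 0 = t * y a 0 - f a * (t * u a 0).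
    by rewrite !mxE mulrBr mulrCA.
  by rewrite ler_ltD// ltrN2 ltr_nM2l.
by rewrite wa mulr0 ltNge Aw0.
Qed.

(** Subtracting from [y] the largest multiple of [x] that leaves w >= 0 creates a zero of [w] at
    some [a]. If w(b) > 0, a power with A^m(a,b) > 0 gives (A^m w)(a) > 0, yet this entry is t^m
    w(a) = 0. *)
Lemma eigenvector_proportional A x y t (i0 : 'I_n) : (forall i j, 0 <= A i j) ->
  irreducible_mx A -> (forall i, 0 < x i 0) -> A *m x = t *: x ->
  A *m y = t *: y -> exists c, y = c *: x.
Proof.
move=> A0 irr x0 Ax Ay.
pose f i := y i 0 / x i 0.
pose a := [arg min_(b < i0) f b]%O.
have fa b : f a <= f b by rewrite /a; case: arg_minP => // c _; apply.
exists (f a); pose w := y - f a *: x.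
have w0 b : 0 <= w b 0.
  by rewrite !mxE subr_ge0 -ler_pdivlMr//; exact: fa.
have wa : w a 0 = 0 by rewrite !mxE /f divfK ?subrr ?gt_eqF.
have Aw : A *m w = t *: w.
  by rewrite mulmxBr -scalemxAr Ax Ay scalerBr scalerA mulrC -scalerA.
apply/eqP; rewrite -subr_eq0 -/w; apply/negPn/negP => wn0.
have Aw' k : A ^+ k *m w = t ^+ k *: w.
  elim: k => [|k IH]; first by rewrite !expr0 mul1mx scale1r.
  by rewrite exprSr -mulmxE -mulmxA Aw -scalemxAr IH scalerA -exprS.
have /cV0Pn[b wb] := wn0.
have [m Am] := irr a b.
have : 0 < (A ^+ m *m w) a 0.
  rewrite mxE (bigD1 b)//= ltr_pwDl//.
    by rewrite mulr_gt0// lt0r ?wb ?w0// Am expmx_ge0.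
  by rewrite sumr_ge0// => c _; rewrite mulr_ge0// expmx_ge0.
by rewrite Aw' mxE wa mulr0 ltxx.
Qed.

Lemma injective_mulmx_solve A : (forall y, A *m y = 0 -> y = 0) ->
  forall b : 'cV[R]_n, exists y, A *m y = b.
Proof.
move=> inj b; have uA : A \in unitmx.
  rewrite -unitmx_tr unitmxE unitfE; apply/det0P => -[v vn0 vA].
  case/eqP: vn0; apply: trmx_inj; rewrite trmx0; apply: inj.
  by apply: trmx_inj; rewrite trmx_mul trmxK vA trmx0.
by exists (invmx A *m b); rewrite mulKVmx.
Qed.

End NonnegativeMatrices.

(** * Kernels on finite sets *)

Section Kernels.
Variables (R : realType) (T : choiceType) (X : {fset T}).
Implicit Types (K : T -> T -> R) (u x y b : T -> R) (t : R) (v w : T).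

(** The enumeration is that of [block_matrix], so that A_{C,i} becomes the matrix of a kernel
    restricted to C. *)
Definition kernel_mx K : 'M[R]_#|{: X}| :=
  \matrix_(a, b) K (val (enum_val a)) (val (enum_val b)).

Definition kernel_col x : 'cV[R]_#|{: X}| := \col_a x (val (enum_val a)).

(** Kernels and vectors live on all of [T], so one vector can be tested against several blocks
    without reindexing. *)
Definition apply_kernel K x v : R := \sum_(w <- X) K v w * x w.

Lemma kernel_mx_col K x :
  kernel_mx K *m kernel_col x = kernel_col (apply_kernel K x).
Proof.
apply/colP => a; rewrite !mxE /apply_kernel big_seq_fsetE/=.
rewrite (reindex_omap (@enum_val _ _) (fun w : X => Some (enum_rank w)))/=.
  apply: eq_big => [c|c _]; last by rewrite !mxE.
  by rewrite enum_valK eqxx.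
by move=> w _; rewrite /= enum_rankK.
Qed.

Lemma kernel_col_forall (P : T -> R -> Prop) x :
  (forall a, P (val (enum_val a)) (kernel_col x a 0)) <->
  {in X, forall v, P v (x v)}.
Proof.
split=> [Px v vX|Px a]; last by rewrite mxE; apply: Px; exact: valP.
by have := Px (enum_rank [` vX]%fset); rewrite mxE enum_rankK.
Qed.

Lemma kernel_col_index v : v \in X ->
  exists a : 'I_#|{: X}|, forall x, kernel_col x a 0 = x v.
Proof.
by move=> vX; exists (enum_rank [` vX]%fset) => x; rewrite mxE enum_rankK.
Qed.

Lemma kernel_col_inj x y : kernel_col x = kernel_col y -> {in X, x =1 y}.
Proof.
by move=> xy v /kernel_col_index[a xa]; rewrite -xa xy xa.
Qed.

Lemma eq_kernel_col x y : {in X, x =1 y} -> kernel_col x = kernel_col y.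
Proof. by move=> xy; apply/colP => a; rewrite !mxE xy//; exact: valP. Qed.

Lemma kernel_col_surj c : exists x, c = kernel_col x.
Proof.
exists (fun v => if insub v is Some w then c (enum_rank w) 0 else 0).
by apply/colP => a; rewrite mxE valK enum_valK.
Qed.

Lemma kernel_colZ t x : kernel_col (fun v => t * x v) = t *: kernel_col x.
Proof. by apply/colP => a; rewrite !mxE. Qed.

Variable K : T -> T -> R.
Hypothesis K0 : forall v w, 0 <= K v w.
Let A0 i j : 0 <= kernel_mx K i j. Proof. by rewrite mxE. Qed.

Lemma kernel_spr_eigen u t v : v \in X -> {in X, forall w, 0 < u w} ->
  {in X, forall w, apply_kernel K u w = t * u w} -> spr (kernel_mx K) = t.
Proof.
move=> /kernel_col_index[a _] u0 Ku.
apply: (@spr_eigen_col _ _ _ (kernel_col u) t a) => //.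
  by apply/(kernel_col_forall (fun _ r => 0 < r)).
by rewrite kernel_mx_col -kernel_colZ; apply: eq_kernel_col.
Qed.

Lemma kernel_maximum_principle u t y : {in X, forall v, 0 < u v} ->
  {in X, forall v, apply_kernel K u v < t * u v} ->
  {in X, forall v, apply_kernel K y v <= t * y v} ->
  {in X, forall v, 0 <= y v}.
Proof.
move=> u0 Ku Ky; apply/(kernel_col_forall (fun _ r => 0 <= r)).
apply: (@maximum_principle _ _ (kernel_mx K) (kernel_col u) t) => // a.
- by rewrite mxE u0//; exact: valP.
- by rewrite kernel_mx_col !mxE Ku//; exact: valP.
- by rewrite kernel_mx_col !mxE Ky//; exact: valP.
Qed.

Lemma kernel_solve : (forall y, {in X, forall v, apply_kernel K y v = 0} ->
    {in X, forall v, y v = 0}) ->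
  forall b, exists y, {in X, apply_kernel K y =1 b}.
Proof.
move=> inj b.
have col0 : kernel_col (fun=> 0) = 0 by apply/colP => a; rewrite !mxE.
have [|c Kc] := @injective_mulmx_solve _ _ (kernel_mx K) _ (kernel_col b).
  move=> c; have [y ->] := kernel_col_surj c.
  rewrite kernel_mx_col -col0 => /kernel_col_inj/inj y0.
  exact: eq_kernel_col.
have [y cy] := kernel_col_surj c; exists y.
by apply: kernel_col_inj; rewrite -kernel_mx_col -cy.
Qed.

Hypothesis irr : irreducible_mx (kernel_mx K).

Lemma kernel_perron_frobenius v : v \in X ->
  exists u, {in X, forall w, 0 < u w} /\
    {in X, forall w, apply_kernel K u w = spr (kernel_mx K) * u w}.
Proof.
move=> /kernel_col_index[a _].
have [c [c0 Kc]] := perron_frobenius_col a A0 irr.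
have [u cu] := kernel_col_surj c; exists u; split.
  by apply/(kernel_col_forall (fun _ r => 0 < r)); rewrite -cu.
by apply: kernel_col_inj; rewrite kernel_colZ -kernel_mx_col -cu.
Qed.

Lemma kernel_spr_lt x t v : {in X, forall w, 0 <= x w} ->
  {in X, forall w, apply_kernel K x w <= t * x w} ->
  v \in X -> apply_kernel K x v < t * x v -> spr (kernel_mx K) < t.
Proof.
move=> x0 Kx /kernel_col_index[a xa] Kxv.
apply: (@spr_lt_subinvariant _ _ (kernel_mx K) (kernel_col x) t a) => //.
- by move=> b; rewrite mxE x0//; exact: valP.
- by move=> b; rewrite kernel_mx_col !mxE Kx//; exact: valP.
- by rewrite kernel_mx_col !xa.
Qed.

Lemma kernel_eigenvector_proportional u y t v : v \in X ->
  {in X, forall w, 0 < u w} ->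
  {in X, forall w, apply_kernel K u w = t * u w} ->
  {in X, forall w, apply_kernel K y w = t * y w} ->
  exists c, {in X, forall w, y w = c * u w}.
Proof.
move=> /kernel_col_index[a _] u0 Ku Ky.
have eig z : {in X, forall w, apply_kernel K z w = t * z w} ->
    kernel_mx K *m kernel_col z = t *: kernel_col z.
  by move=> Kz; rewrite kernel_mx_col -kernel_colZ; apply: eq_kernel_col.
have [|c yc] := eigenvector_proportional a A0 irr _ (eig _ Ku) (eig _ Ky).
  by apply/(kernel_col_forall (fun _ r => 0 < r)).
by exists c; apply: kernel_col_inj; rewrite kernel_colZ.
Qed.

End Kernels.

Section ApplyKernel.
Variables (R : realType) (T : choiceType).
Implicit Types (K : T -> T -> R) (V X : {fset T}) (x y : T -> R).

Lemma apply_kernel_split K V X y v : {subset X <= V} ->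
  apply_kernel V K y v =
  apply_kernel X K y v + \sum_(w <- [fset w in V | w \notin X]%fset) K v w * y w.
Proof.
move=> XV; rewrite /apply_kernel (big_fsetID _ (mem X))/=; congr (_ + _).
apply: eq_fbig => // w; rewrite !inE/= andbC.
by apply/andP/idP => [[]//|wX]; split => //; exact: XV.
Qed.

Lemma apply_kernel_comm K K' V y v :
  {in V &, forall w u,
    \sum_(q <- V) K w q * K' q u = \sum_(q <- V) K' w q * K q u} ->
  v \in V ->
  apply_kernel V K (apply_kernel V K' y) v =
  apply_kernel V K' (apply_kernel V K y) v.
Proof.
move=> KK' vV; rewrite /apply_kernel.
under eq_bigr do rewrite mulr_sumr.
under [RHS]eq_bigr do rewrite mulr_sumr.
rewrite exchange_big [RHS]exchange_big/= big_seq [RHS]big_seq.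
apply: eq_bigr => u uV.
under eq_bigr do rewrite mulrA.
under [RHS]eq_bigr do rewrite mulrA.
by rewrite -!mulr_suml KK'.
Qed.

Lemma apply_kernelN K V y v :
  apply_kernel V K (fun w => - y w) v = - apply_kernel V K y v.
Proof.
by rewrite /apply_kernel -sumrN; apply: eq_bigr => w _; rewrite mulrN.
Qed.

Lemma apply_kernelB K V x y v :
  apply_kernel V K (fun w => x w - y w) v =
  apply_kernel V K x v - apply_kernel V K y v.
Proof.
by rewrite /apply_kernel -sumrB; apply: eq_bigr => w _; rewrite mulrBr.
Qed.

Lemma apply_kernelZ K V t y v :
  apply_kernel V K (fun w => t * y w) v = t * apply_kernel V K y v.
Proof.
by rewrite /apply_kernel mulr_sumr; apply: eq_bigr => w _; rewrite mulrCA.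
Qed.

Lemma eq_apply_kernel K V x y v : {in V, x =1 y} ->
  apply_kernel V K x v = apply_kernel V K y v.
Proof.
move=> xy; rewrite /apply_kernel big_seq [RHS]big_seq.
by apply: eq_bigr => w wV; rewrite xy.
Qed.

Lemma sum_delta V y v : v \in V -> \sum_(w <- V) (v == w)%:R * y w = y v.
Proof.
move=> vV; rewrite (big_fsetD1 v)//= eqxx mul1r big_seq big1 ?addr0// => w.
by rewrite !inE eq_sym => /andP[/negbTE-> _]; rewrite mul0r.
Qed.

End ApplyKernel.

(** * k-graphs *)

Section Graph.
Variables (k : nat) (L : kgraph k).
Hypothesis Lfin : finite_kgraph L.
Implicit Types (v w : vert L) (C D X : set (vert L)) (l : L).

Lemma finite_vert X : finite_set X.
Proof.
apply: (@sub_finite_set _ _ (@src _ L @` degset L 0)).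
  by move=> v _; exists (idm v); rewrite ?src_idm//; exact: deg_idm.
exact/finite_image/Lfin.
Qed.

Lemma finite_paths v w n : finite_set (paths [set v] (degset L n) [set w]).
Proof. by apply: (sub_finite_set _ (Lfin n)) => l []. Qed.

Lemma in_vert X v : (v \in fset_set X) <-> X v.
Proof. by rewrite in_fset_set ?inE//; exact: finite_vert. Qed.

Lemma reaches_refl v : reaches v v.
Proof. by exists (idm v); split; rewrite /= ?src_idm ?rng_idm. Qed.

Lemma reaches_trans u v w : reaches v u -> reaches u w -> reaches v w.
Proof.
move=> [l [_ /= lv lu]] [m [_ /= mu mw]]; have lm : src l = rng m by rewrite lu.
by exists (compose l m); split; rewrite //= ?rng_comp ?src_comp.
Qed.

Lemma vertex_matrix_gt0 i v w : (0 < vertex_matrix i v w)%N <->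
  exists l, [/\ deg l = unitdeg i, rng l = v & src l = w].
Proof.
rewrite /vertex_matrix cardfs_gt0; split.
  by move=> /fset0Pn[l]; rewrite in_fset_set ?inE;
    [move=> [? ? ?]; exists l|exact: finite_paths].
move=> [l [dl rl sl]]; apply/fset0Pn; exists l.
by rewrite in_fset_set ?inE//; exact: finite_paths.
Qed.

Lemma vertex_matrix_reaches i v w : (0 < vertex_matrix i v w)%N -> reaches v w.
Proof. by move=> /vertex_matrix_gt0[l [_ rl sl]]; exists l. Qed.

(** Both (l, id) and (id, l) factor [l] along 0 = 0 + 0, so they coincide and [l] is an identity. *)
Lemma deg0_rng_src l : deg l = 0 -> rng l = src l.
Proof.
move=> l0; have [|p [_ puniq]] := @factorization _ _ l 0 0; first by rewrite addr0.
have p1 : p = (l, idm (src l)).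
  by apply: puniq; split; rewrite /= ?rng_idm ?deg_idm ?comp_idr.
have p2 : p = (idm (rng l), l).
  by apply: puniq; split; rewrite /= ?src_idm ?deg_idm ?comp_idl.
have [e _] : (l, idm (src l)) = (idm (rng l), l) by rewrite -p1.
by rewrite [in RHS]e src_idm.
Qed.

(** Unique factorization makes composition a bijection from composable pairs of degrees [m] and [n]
    onto paths of degree m + n; the sum sorts the pairs by their middle vertex. *)
Lemma card_paths_compose m n v u :
  (\sum_(w <- fset_set [set: vert L])
    #|` fset_set (paths [set v] (degset L m) [set w])| *
    #|` fset_set (paths [set w] (degset L n) [set u])|)%N =
  #|` fset_set (paths [set v] (degset L (m + n)) [set u])|.
Proof.
pose P a d b := fset_set (paths [set a] (degset L d) [set b]).
have inP a d b l : l \in P a d b <-> [/\ deg l = d, rng l = a & src l = b].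
  rewrite in_fset_set; last exact: finite_paths.
  by rewrite inE.
pose s := [seq compose q.1 q.2 | w <- fset_set [set: vert L],
  q <- [seq (a, b) | a <- P v m w, b <- P w n u]].
have -> : #|` P v (m + n) u| = size s.
  apply/perm_size/uniq_perm; first exact: fset_uniq.
    apply: allpairs_uniq_dep; first exact: fset_uniq.
      move=> w _; apply: allpairs_uniq; [exact: fset_uniq|exact: fset_uniq|].
      by move=> [a b] [a' b'] _ _ [-> ->].
    (* Two pairs with equal composites are factorizations of one path, hence equal; the middle
       vertex is then the source of the first factor. *)
    move=> p0 p0'.
    move=> /allpairsPdep[w1 [q [_ /allpairsP[[a1 b1]] /=]]].
    move=> [/inP[da ra sa] /inP[db rb sb] ->] -> {p0}.
    move=> /allpairsPdep[w2 [q' [_ /allpairsP[[a2 b2]] /=]]].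
    move=> [/inP[da' ra' sa'] /inP[db' rb' sb'] ->] -> {p0'} /= e.
    have e1 : deg (compose a1 b1) = m + n by rewrite deg_comp ?da ?db// sa rb.
    have [p [_ puniq]] := factorization e1.
    have p1 : p = (a1, b1) by apply: puniq; split; rewrite //= sa rb.
    have p2 : p = (a2, b2) by apply: puniq; split; rewrite //= sa' rb'.
    have [ea eb] : (a1, b1) = (a2, b2) by rewrite -p1.
    by subst a2 b2; subst w1 w2.
  move=> l; apply/idP/idP.
    move=> /inP[dl rl sl]; have [p [[sp d1 d2 lp] _]] := factorization dl.
    apply/allpairsPdep; exists (src p.1), p; split => //; first exact/in_vert.
    apply/allpairsP; exists p; split; [apply/inP|apply/inP|by case: (p)].
      by split => //; rewrite -rl lp rng_comp.
    by split => //; rewrite -sl lp src_comp.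
  move=> /allpairsPdep[w [q [_ /allpairsP[[a b] /=]]]].
  move=> [/inP[da ra sa] /inP[db rb sb] ->] ->; apply/inP.
  have ab : src a = rng b by rewrite sa.
  by split; rewrite /= ?deg_comp ?da ?db ?rng_comp ?src_comp.
rewrite size_allpairs_dep sumnE big_map; apply: eq_bigr => w _.
by rewrite size_allpairs.
Qed.

(** Both sides count the paths from [u] to [v] of degree e_i + e_j. *)
Lemma vertex_matrix_comm i j v u :
  (\sum_(w <- fset_set [set: vert L]) vertex_matrix i v w * vertex_matrix j w u =
   \sum_(w <- fset_set [set: vert L]) vertex_matrix j v w * vertex_matrix i w u)%N.
Proof. by rewrite !card_paths_compose addrC. Qed.

Lemma mem_class v w : [set u | reaches v u /\ reaches u v] w ->
  [set u | reaches v u /\ reaches u v] = [set u | reaches w u /\ reaches u w].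
Proof.
move=> [vw wv]; apply/seteqP; split => u /= [h1 h2]; split;
  by [exact: reaches_trans h1|exact: reaches_trans h2 _
     |exact: reaches_trans wv h1|exact: reaches_trans vw h1
     |exact: reaches_trans h2 vw|exact: reaches_trans h2 wv].
Qed.

Lemma ncomponentsE C v : ncomponents L C -> C v ->
  C = [set u | reaches v u /\ reaches u v].
Proof. by move=> [[w ->] _]; exact: mem_class. Qed.

(** In a trivial class an edge would be an identity, of degree 0 instead of e_i. *)
Lemma class_ncomponent i v w : reaches v w -> reaches w v ->
  (0 < vertex_matrix i v w)%N ->
  ncomponents L [set u | reaches v u /\ reaches u v].
Proof.
move=> vw wv vw0; split; first by exists v.
move=> [x [Cx xx]].
have xC u : reaches v u -> reaches u v -> u = x.
  by move=> h1 h2; have : [set x] u by rewrite -Cx.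
have vx := xC v (reaches_refl v) (reaches_refl v).
have wx := xC w vw wv.
have /vertex_matrix_gt0[l [dl rl sl]] := vw0.
have : [set idm x] l by rewrite -xx; split => //=; rewrite ?rl ?sl.
move=> /= lx; move: dl; rewrite lx deg_idm => /rowP/(_ i).
by rewrite !mxE !eqxx.
Qed.

End Graph.

(** * Vertex matrices as real kernels *)

Section VertexKernels.
Variables (R : realType) (k : nat) (L : kgraph k).
Hypothesis Lfin : finite_kgraph L.
Hypothesis Lirr : forall C, ncomponents L C -> coordinatewise_irreducible C.
Implicit Types (v w : vert L) (C D X : set (vert L)) (l : L) (y : vert L -> R).

Definition vkernel i v w : R := (vertex_matrix i v w)%:R.

Lemma vkernel_ge0 i v w : 0 <= vkernel i v w. Proof. exact: ler0n. Qed.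

Lemma vkernel_mx_block C i :
  kernel_mx (fset_set C) (vkernel i) = map_mx (fun n => n%:R) (block_matrix C i).
Proof. by apply/matrixP => a b; rewrite !mxE. Qed.

Lemma rhoE C i : rho R C i = spr (kernel_mx (fset_set C) (vkernel i)).
Proof.
rewrite /rho /spr vkernel_mx_block; congr spectral_radius.
by apply/matrixP => a b; rewrite !mxE rmorph_nat.
Qed.

Lemma vkernel_irreducible C i : ncomponents L C ->
  irreducible_mx (kernel_mx (fset_set C) (vkernel i)).
Proof.
move=> /Lirr/(_ i) irr a b; have [m Am] := irr a b; exists m.
suff -> : kernel_mx (fset_set C) (vkernel i) ^+ m =
    map_mx (fun n => n%:R) (block_matrix C i ^+ m) by rewrite mxE pnatr_eq0.
rewrite vkernel_mx_block; elim: m {Am} => [|m IH].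
  by apply/matrixP => c d; rewrite !expr0 !mxE; case: eqP.
rewrite !exprS IH -!mulmxE; apply/matrixP => c d.
rewrite !mxE natr_sum; apply: eq_bigr => e _.
by rewrite !mxE natrM.
Qed.

Lemma vkernel_eq0 i v w : ~ reaches v w -> vkernel i v w = 0.
Proof.
move=> nvw; apply/eqP; rewrite pnatr_eq0 -leqn0 leqNgt; apply/negP.
by move=> /(vertex_matrix_reaches Lfin).
Qed.

Local Notation V := (fset_set [set: vert L]).

Lemma in_allvert v : v \in V. Proof. exact/in_vert. Qed.

Lemma vkernel_comm i j y v :
  apply_kernel V (vkernel i) (apply_kernel V (vkernel j) y) v =
  apply_kernel V (vkernel j) (apply_kernel V (vkernel i) y) v.
Proof.
apply: apply_kernel_comm; last exact: in_allvert.
move=> w u _ _; have := vertex_matrix_comm Lfin i j w u.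
move=> /(congr1 (fun n => n%:R : R)); rewrite !natr_sum.
by under eq_bigr do rewrite natrM; under [X in _ = X -> _]eq_bigr do rewrite natrM.
Qed.

Lemma sub_allvert X : {subset fset_set X <= V}.
Proof. by move=> v _; exact: in_allvert. Qed.

(** Edges with range in D have their source in D, so the rows of A_i indexed by D vanish off D. *)
Lemma apply_vkernel_hereditary D i y v : hereditary D -> D v ->
  apply_kernel V (vkernel i) y v = apply_kernel (fset_set D) (vkernel i) y v.
Proof.
move=> Dher Dv; rewrite (apply_kernel_split _ _ _ (@sub_allvert D)).
rewrite [X in _ + X]big_seq [X in _ + X]big1 ?addr0// => w.
rewrite !inE => /andP[_ wD].
rewrite vkernel_eq0 ?mul0r// => vw; case/negP: wD.
by apply/in_vert => //; exact: Dher vw.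
Qed.

(** * Maximum principle and eigenvector extension off a hereditary set *)

Section MaximumPrinciple.
Variables (D : set (vert L)) (j : 'I_k) (t : R).
Hypothesis Dher : hereditary D.
Hypothesis t0 : 0 < t.
Hypothesis Ct : forall C, (ncomponents L `\ D) C -> rho R C j < t.

(** Supplies the strict supersolution for the diagonal block of [v]. On a nontrivial class it is the
    Perron-Frobenius vector, as the block has spectral radius below [t]; on any other class the
    block is zero and the constant 1 works because t > 0. *)
Lemma class_subinvariant v : ~ D v ->
  exists u, {in fset_set [set w | reaches v w /\ reaches w v],
    forall w, 0 < u w /\
    apply_kernel (fset_set [set w | reaches v w /\ reaches w v]) (vkernel j) u w
      < t * u w}.
Proof.
move=> Dv; set C := [set w | _].
have Cv : v \in fset_set C by apply/in_vert => //; split; exact: reaches_refl.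
have [nC|nC] := pselect (ncomponents L C).
  have [u [u0 Ku]] := kernel_perron_frobenius (@vkernel_ge0 j)
    (vkernel_irreducible j nC) Cv.
  exists u => w wC; split; first exact: u0.
  rewrite Ku// -rhoE ltr_pM2r ?u0//; apply: Ct; split => //= CD.
  by apply: Dv; rewrite -CD; exact/(in_vert Lfin).
exists (fun=> 1) => w /(in_vert Lfin) Cw; split; first exact: ltr01.
rewrite mulr1 /apply_kernel big_seq big1// => u /(in_vert Lfin) Cu.
rewrite mulr1; apply/eqP; rewrite pnatr_eq0 -leqn0 leqNgt; apply/negP => wu.
apply: nC; rewrite /C (mem_class Cw).
move: Cw Cu => [vw wv] [vu uv].
apply: class_ncomponent wu => //; first exact: reaches_trans vu.
exact: reaches_trans vw.
Qed.

(* On the class of [v], the vertices that are reached but outside of the class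
   contribute nonnegatively by induction, so the principle reduces to the
   diagonal blocks. *)
Lemma graph_maximum_principle y : (forall v, D v -> 0 <= y v) ->
  (forall v, ~ D v -> apply_kernel V (vkernel j) y v <= t * y v) ->
  forall v, 0 <= y v.
Proof.
move=> yD yV v.
(* The induction is on the number of vertices reached from [v], which drops strictly at a vertex
   reached from [v] that does not reach back. *)
have [n] := ubnP #|` fset_set [set w | reaches v w]|.
elim: n v => // n IH v; rewrite ltnS => vn.
have [Dv|Dv] := pselect (D v); first exact: yD.
have [u uP] := class_subinvariant Dv; set C := [set w | _] in uP.
have Cv : v \in fset_set C by apply/in_vert => //; split; exact: reaches_refl.
apply: (@kernel_maximum_principle _ _ _ _ (@vkernel_ge0 j) u t y) Cv.
- by move=> w /uP[].
- by move=> w /uP[].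
move=> w /(in_vert Lfin) Cw; have [vw wv] := Cw.
have Dw : ~ D w by move=> Dw; apply: Dv; exact: Dher wv.
apply: le_trans (yV w Dw); rewrite (apply_kernel_split _ _ _ (@sub_allvert C)).
rewrite lerDl big_seq sumr_ge0// => q; rewrite !inE => /andP[_ qC].
have [wq|nwq] := pselect (reaches w q); last by rewrite vkernel_eq0// mul0r.
have vq := reaches_trans vw wq.
have nqv : ~ reaches q v by move=> qv; case/negP: qC; apply/in_vert.
rewrite mulr_ge0 ?vkernel_ge0//; apply: IH; apply: leq_trans vn.
apply: fproper_ltn_card; rewrite fproperE; apply/andP; split.
  apply/fsubsetP => r /(in_vert Lfin) /= qr; apply/in_vert => //.
  exact: reaches_trans qr.
apply/fsubsetPn; exists v; first by apply/in_vert => //; exact: reaches_refl.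
by apply/negP => /(in_vert Lfin).
Qed.

(** The maximum principle applies to both [y] and -y. *)
Lemma graph_uniqueness y : (forall v, D v -> y v = 0) ->
  (forall v, ~ D v -> apply_kernel V (vkernel j) y v = t * y v) ->
  forall v, y v = 0.
Proof.
move=> yD yV v; apply/le_anti/andP; split; last first.
  by apply: graph_maximum_principle => w Dw; [rewrite yD|rewrite yV].
rewrite -oppr_ge0; apply: (graph_maximum_principle (y := fun w => - y w)) => w Dw.
  by rewrite yD// oppr0.
by rewrite apply_kernelN yV// mulrN.
Qed.

(** The two conditions form one square linear system, so existence follows from uniqueness. *)
Lemma graph_extension x : exists z, (forall v, D v -> z v = x v) /\
  forall v, ~ D v -> apply_kernel V (vkernel j) z v = t * z v.
Proof.
(* Rows of the identity on D prescribe [x] there; rows of t - A_j off D express the eigenvector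
   equation. *)
pose K v w : R := if v \in fset_set D then (v == w)%:R
  else t * (v == w)%:R - vkernel j v w.
have KE y v : apply_kernel V K y v = if v \in fset_set D then y v
    else t * y v - apply_kernel V (vkernel j) y v.
  rewrite /apply_kernel /K; case: ifP => vD; first exact/sum_delta/in_allvert.
  under eq_bigr do rewrite mulrBl -mulrA.
  by rewrite sumrB -mulr_sumr sum_delta//; exact: in_allvert.
have [y Ky|z Kz] := @kernel_solve R _ V K _
    (fun v => if v \in fset_set D then x v else 0).
  move=> v _; apply: graph_uniqueness v => v Dv; have := Ky v (in_allvert v).
    by rewrite KE ifT//; apply/in_vert.
  rewrite KE ifF; first by move/eqP; rewrite subr_eq0 => /eqP.
  by apply/negbTE/negP => /(in_vert Lfin).
exists z; split=> v Dv; have := Kz v (in_allvert v); rewrite KE.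
  by have /(in_vert Lfin) -> := Dv.
have /negbTE -> : v \notin fset_set D by apply/negP => /(in_vert Lfin).
by move/eqP; rewrite subr_eq0 => /eqP.
Qed.

End MaximumPrinciple.

(** * Positivity of an eigenvector along paths *)

Section Paths.
Variables (i : 'I_k) (t : R) (z : vert L -> R).
Hypothesis z0 : forall v, 0 <= z v.
Hypothesis Az : forall v, apply_kernel V (vkernel i) z v = t * z v.

Lemma unitdegS l n : deg l = unitdeg i *+ n.+1 -> exists a b,
  [/\ src a = rng b, deg a = unitdeg i, deg b = unitdeg i *+ n & l = compose a b].
Proof.
by rewrite mulrS => /factorization[[a b] [[/= ? ? ? ?] _]]; exists a, b.
Qed.

Lemma vkernel_edge_gt0 l : deg l = unitdeg i -> 0 < vkernel i (rng l) (src l).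
Proof. by move=> dl; rewrite ltr0n; apply/vertex_matrix_gt0 => //; exists l. Qed.

(** Positivity spreads from source to range one edge at a time: an edge whose source carries a
    positive value makes A_i z, hence [z], positive at its range. *)
Lemma eigen_pos_path n l : deg l = unitdeg i *+ n -> 0 < z (src l) ->
  0 < z (rng l).
Proof.
elim: n l => [|n IH] l.
  by rewrite mulr0n => /deg0_rng_src->.
move=> /unitdegS[a [b [ab da db ->]]]; rewrite src_comp// rng_comp// => zb.
have za : 0 < z (src a) by rewrite ab; exact: IH.
rewrite lt_neqAle z0 andbT eq_sym; apply/eqP => zr.
have : 0 < apply_kernel V (vkernel i) z (rng a).
  rewrite /apply_kernel (big_fsetD1 (src a)) ?in_allvert//= ltr_pwDl//.
    by rewrite mulr_gt0// vkernel_edge_gt0.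
  by rewrite sumr_ge0// => w _; rewrite mulr_ge0// vkernel_ge0.
by rewrite Az zr mulr0 ltxx.
Qed.

(** Read from its range, the path has a first edge leaving [X]; the rest of the path carries
    positivity from [src l] to the source [w] of that edge. *)
Lemma path_leaves X n l : deg l = unitdeg i *+ n -> 0 < z (src l) ->
  X (rng l) -> ~ X (src l) ->
  exists v w, [/\ X v, ~ X w, 0 < vkernel i v w & 0 < z w].
Proof.
elim: n l => [|n IH] l.
  by rewrite mulr0n => /deg0_rng_src->.
move=> /unitdegS[a [b [ab da db ->]]]; rewrite src_comp// rng_comp// => zb Xa nXb.
have [Xab|nXab] := pselect (X (rng b)); first exact: (IH b).
exists (rng a), (src a); split => //; rewrite ?ab//; last exact: eigen_pos_path db zb.
by rewrite -ab; exact: vkernel_edge_gt0.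
Qed.

End Paths.
End VertexKernels.

(** * Comparison of the spectral radii of C and D *)

Theorem corollary4p3 (R : realType) (k : nat) (L : kgraph k)
    (Lfin : finite_kgraph L)
    (Lsinks : no_sinks L)
    (Lsources : no_sources L)
    (Lirr : forall C, ncomponents L C -> coordinatewise_irreducible C)
    (D : set (vert L))
    (Dcomp : ncomponents L D)
    (Dher : hereditary D)
    (CDpaths : forall C, ncomponents L C ->
       forall i : 'I_k, paths C (degray L i) D !=set0)
    (hj : exists j : 'I_k,
       forall C, (ncomponents L `\ D) C -> rho R C j < rho R D j) :
  forall C, (ncomponents L `\ D) C ->
  forall i : 'I_k, rho R C i < rho R D i.
Proof.
move: hj => [j hj] C [Ccomp CD] i.
have [v0 Dv0] : exists v, D v.
  by have [[v ->] _] := Dcomp; exists v; split; exact: reaches_refl.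
have inD v : v \in fset_set D <-> D v by exact: in_vert.
have Dv0' := (inD v0).2 Dv0.
have [x [x0 Kx]] := kernel_perron_frobenius (@vkernel_ge0 R _ L j)
  (vkernel_irreducible R Lirr j Dcomp) Dv0'.
rewrite -rhoE in Kx; set t := rho R D j in Kx hj.
(* Without sources, some edge of degree e_j ends at [v0]; it starts in D by heredity, so A_{D,j} x
   is positive at [v0]. *)
have t0 : 0 < t.
  rewrite -(pmulr_lgt0 _ (x0 _ Dv0')) -Kx//.
  have [l [/= dl rl _]] := Lsources v0 (unitdeg j).
  have Dl : src l \in fset_set D by apply/inD/(Dher _ _ Dv0); exists l.
  rewrite /apply_kernel (big_fsetD1 (src l))//= ltr_pwDl//.
    by rewrite mulr_gt0 ?x0// -rl vkernel_edge_gt0.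
  rewrite big_seq sumr_ge0// => w; rewrite !inE => /andP[_ wD].
  by rewrite mulr_ge0 ?vkernel_ge0// ltW// x0.
have [z [zD zE]] := graph_extension Lfin Lirr Dher t0 hj x.
pose A n := apply_kernel (fset_set [set: vert L]) (@vkernel R _ L n).
have AD n y v : D v -> A n y v = apply_kernel (fset_set D) (vkernel R n) y v.
  exact: apply_vkernel_hereditary.
have ADz n v : D v -> A n z v = apply_kernel (fset_set D) (vkernel R n) x v.
  move=> Dv; rewrite AD//; apply: eq_apply_kernel => w /inD; exact: zD.
have z0 : forall v, 0 <= z v.
  apply: (graph_maximum_principle Lfin Lirr Dher t0 hj) => v Dv.
    by rewrite zD// ltW// x0//; apply/inD.
  by rewrite zE.
have Ajz v : A j z v = t * z v.
  have [Dv|Dv] := pselect (D v); last exact: zE.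
  by rewrite ADz// Kx ?zD//; apply/inD.
have Aiz v : A i z v = rho R D i * z v.
  have AA v' : A j (A i z) v' = t * A i z v'.
    rewrite /A (vkernel_comm Lfin) -apply_kernelZ.
    by apply: eq_apply_kernel => w _; exact: Ajz.
  (* A_i z is again an eigenvector of A_j for [t]; on D it equals A_{D,i} x, which is therefore a
     multiple of [x]. *)
  have [|c xc] := kernel_eigenvector_proportional (@vkernel_ge0 R _ L j)
    (vkernel_irreducible R Lirr j Dcomp) Dv0' x0 Kx
    (y := apply_kernel (fset_set D) (vkernel R i) x).
    move=> w /inD Dw; rewrite -ADz// -AA AD//.
    by apply: eq_apply_kernel => u /inD Du; rewrite ADz.
  (* The eigenvalue of a positive eigenvector is the spectral radius. *)
  have -> : rho R D i = c.
    by rewrite rhoE (kernel_spr_eigen (@vkernel_ge0 R _ L i) Dv0' x0 xc).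
  apply/eqP; rewrite -subr_eq0; apply/eqP.
  (* A_i z - c z vanishes on D and satisfies the eigenvector equation of A_j off D. *)
  apply: (graph_uniqueness Lfin Lirr Dher t0 hj
    (y := fun v => A i z v - c * z v)) v => v Dv.
    by rewrite ADz// zD// xc ?subrr//; apply/inD.
  have -> := apply_kernelB (vkernel R j) _ (A i z) (fun v => c * z v) v.
  have -> := apply_kernelZ (vkernel R j) _ c z v.
  rewrite mulrBr mulrCA; congr (_ - c * _).
  - exact: AA.
  - exact: Ajz.
have inC v : v \in fset_set C <-> C v by exact: in_vert.
(* Strongly connected components that meet are equal. *)
have dCD v : C v -> ~ D v.
  by move=> Cv Dv; apply: CD; rewrite /= (ncomponentsE Ccomp Cv)
    (ncomponentsE Dcomp Dv).
have [l [[n _ dl] Cl Dl]] := CDpaths _ Ccomp i.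
have zl : 0 < z (src l) by rewrite zD// x0//; apply/inD.
have [v [w [Cv nCw vw zw]]] : exists v w, [/\ C v, ~ C w,
    0 < vkernel R i v w & 0 < z w].
  by apply: (path_leaves Lfin z0 Aiz dl zl) => // /dCD.
have split_C u := apply_kernel_split (vkernel R i) z u (@sub_allvert _ _ Lfin C).
rewrite rhoE; apply: (kernel_spr_lt (v := v) (@vkernel_ge0 R _ L i)
  (vkernel_irreducible R Lirr i Ccomp) (x := z)) => //.
- move=> u _; rewrite -Aiz /A split_C lerDl sumr_ge0// => q _.
  by rewrite mulr_ge0// vkernel_ge0.
- exact/inC.
(* Strictness at [v]: the part of the row outside C contains the positive term A_i(v,w) z(w). *)
rewrite -Aiz /A split_C ltrDl (big_fsetD1 w)//=; last first.
  by rewrite !inE in_allvert//=; apply/negP => /inC.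
rewrite ltr_pwDl ?mulr_gt0// sumr_ge0// => q _.
by rewrite mulr_ge0// vkernel_ge0.
Qed.
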